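(* Let $j\in N$. Then $$\operatorname{conv}(\mathcal{B}_j^{\ge})=\bigl\{(x_j,y_0,\boldsymbol{y})\in[0,1]\times Y: (\mathrm{Under}_S)\text{ holds for all }S\subseteq N\setminus\{j\}\bigr\},$$ $$\operatorname{conv}(\mathcal{B}_j^{\le})=\bigl\{(x_j,y_0,\boldsymbol{y})\in[0,1]\times Y: (\mathrm{Over}_S)\text{ holds for all }S\subseteq N\setminus\{j\}\bigr\},$$ and moreover $$\operatorname{conv}(\mathcal{B}_j)=\bigl\{(x_j,y_0,\boldsymbol{y})\in[0,1]\times Y: (\mathrm{Under}_S)\text{ and }(\mathrm{Over}_S)\text{ hold for all }S\subseteq N\setminus\{j\}\bigr\}.$$
   Context: $N=\{1,\dots,n\}$; $u_0>0$ and $u_k\ge0$ for $k\in N$ are given. For $S\subseteq N$, $\alpha(S)=1/(u_0+\sum_{i\in S}u_i)$. Let $$Y=\Bigl\{(y_0,\boldsymbol{y})\in\mathbb{R}^{n+1}: u_0y_0+\sum_{k\in N}u_ky_k=1,\ 0\le y_k\le y_0\text{ for all }k\in N\Bigr\},$$ and $$\mathcal{B}_j=\{(x_j,y_0,\boldsymbol{y})\in\{0,1\}\times Y: y_j=y_0x_j\},$$ $$\mathcal{B}_j^{\le}=\{(x_j,y_0,\boldsymbol{y})\in\{0,1\}\times Y: y_j\le y_0x_j\},\qquad \mathcal{B}_j^{\ge}=\{(x_j,y_0,\boldsymbol{y})\in\{0,1\}\times Y: y_j\ge y_0x_j\}.$$ For $S\subseteq N\setminus\{j\}$: $$(\mathrm{Under}_S)\quad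 y_j\ge \alpha(S\cup\{j\})x_j-\sum_{t\in N\setminus(S\cup\{j\})}u_t\,\alpha(S\cup\{j\})\,y_t,$$ $$(\mathrm{Over}_S)\quad y_j\le \alpha(S\cup\{j\})x_j+\bigl(1-(u_0+u_j)\alpha(S\cup\{j\})\bigr)y_0-\sum_{t\in S}u_t\,\alpha(S\cup\{j\})\,y_t.$$ *)

(* Defs.v *)
From mathcomp Require Import all_boot all_order all_algebra.
From mathcomp Require Import boolp classical_sets set_interval reals convex.

Set Implicit Arguments.
Unset Strict Implicit.
Unset Printing Implicit Defensive.

Import Order.TTheory GRing.Theory Num.Theory.

Local Open Scope classical_set_scope.
Local Open Scope ring_scope.

Definition convex_hull (R : realType) (E : lmodType R) (A : set E) : set E :=
  smallest (@convex_set R E) A.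

(* The triple (x_j, y_0, y) is [p : pspace R n], with x_j = [p.1],
   y_0 = [p.2.1] and y_k = [p.2.2 0 k]; the index set N is ['I_n].  [R^o] is
   [R] as a module over itself, which makes both products [lmodType R]. *)
Notation yspace R n := (R^o * 'rV[R]_n)%type.
Notation pspace R n := (R^o * (R^o * 'rV[R]_n))%type.

Section Sets.
Variables (R : realType) (n : nat) (u0 : R) (u : 'I_n -> R).

Definition alpha (S : {set 'I_n}) : R := (u0 + \sum_(i in S) u i)^-1.

Definition Y : set (yspace R n) :=
  [set q : yspace R n | u0 * q.1 + \sum_(k < n) u k * q.2 0 k = 1 /\
           forall k : 'I_n, 0 <= q.2 0 k <= q.1].

Definition B_eq (j : 'I_n) : set (pspace R n) :=
  [set p : pspace R n | ([set 0; 1] `*` Y) p /\ p.2.2 0 j = p.2.1 * p.1].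

Definition B_le (j : 'I_n) : set (pspace R n) :=
  [set p : pspace R n | ([set 0; 1] `*` Y) p /\ p.2.2 0 j <= p.2.1 * p.1].

Definition B_ge (j : 'I_n) : set (pspace R n) :=
  [set p : pspace R n | ([set 0; 1] `*` Y) p /\ p.2.2 0 j >= p.2.1 * p.1].

Definition under_ineq (j : 'I_n) (S : {set 'I_n}) (p : pspace R n) : Prop :=
  p.2.2 0 j >= alpha (j |: S) * p.1
               - \sum_(t | t \notin j |: S) u t * alpha (j |: S) * p.2.2 0 t.

Definition over_ineq (j : 'I_n) (S : {set 'I_n}) (p : pspace R n) : Prop :=
  p.2.2 0 j <= alpha (j |: S) * p.1
               + (1 - (u0 + u j) * alpha (j |: S)) * p.2.1
               - \sum_(t in S) u t * alpha (j |: S) * p.2.2 0 t.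

End Sets.

(* Main.v *)
Require Import Defs.
From mathcomp Require Import all_boot all_order all_algebra.
From mathcomp Require Import boolp classical_sets set_interval reals convex.
From mathcomp Require Import interval_inference.
From mathcomp Require Import ring lra.

(** Write [q = (y_0, y)] and [mass q = u_0 y_0 + \sum_k u_k y_k], so that [Y] is
    the slice [mass = 1] of the cone [0 <= y_k <= y_0].  Each of the three sets
    is a union of two slices, [x_j = 0] with [q] in a convex cone [K0] and
    [x_j = 1] with [q] in a convex cone [K1].  By homogenizing the convex
    combinations (Balas), [(x, q)] lies in the hull iff [q = a + b] with [a] in
    [K1] of mass [x] and [b] in [K0]; see [convex_hull_two_slices].  The cones
    are cut out of the ambient one by [y_0 <= y_j], which is what
    [y_j >= y_0 x_j] requires at [x_j = 1], and by [y_j <= 0], which is what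
    [y_j <= y_0 x_j] requires at [x_j = 0].

    Which masses can [a] have?  If [a] satisfies [a_0 <= a_j] then [a] is
    dominated by [top_part q], whose entries are [y_j] and [min y_j y_k]; if [b]
    satisfies [b_j <= 0] then [b] is dominated by [bottom_part q], whose
    entries are [y_0 - y_j], [min (y_0 - y_j) y_k], and [0] in position [j].
    Hence [x <= mass (top_part q)], respectively
    [1 - x <= mass (bottom_part q)], is necessary.  It is also sufficient: both
    parts can be subtracted from [q] without leaving the ambient cone, so the
    admissible [a] contain a segment that joins [0] to [top_part q],
    respectively [q - bottom_part q] to [q], respectively
    [q - bottom_part q] to [top_part q] when both constraints are imposed, and
    the mass is affine along it ([split_between]).

    Finally [mass (top_part q)] and [mass (bottom_part q)] are sums of minima,
    and choosing in each minimum one of its two terms, according to whether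
    [k] belongs to [S], gives the families Under_S and Over_S up to the positive
    factor [alpha (S U {j})] ([under_all_iff], [over_all_iff]). *)

Set Implicit Arguments.
Unset Strict Implicit.
Unset Printing Implicit Defensive.

Import Order.TTheory GRing.Theory Num.Theory.

Local Open Scope classical_set_scope.
Local Open Scope ring_scope.

(** * Convex combinations *)

Lemma convex_setP (R : realType) (E : lmodType R) (A : set E) :
  convex_set A <->
  forall (s t : R) (a b : E), 0 <= s -> 0 <= t -> s + t = 1 ->
    A a -> A b -> A (s *: a + t *: b).
Proof.
split=> [cA s t a b s0 t0 st Aa Ab | cA a b l /set_mem Aa /set_mem Ab].
- have s01 : Itv.spec (@Itv.num_sem R) (Itv.Real `[0%Z, 1%Z]) s.
    by apply/and3P; split; rewrite ?num_real // bnd_simp /=; lra.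
  have -> : t = 1 - s by lra.
  exact: set_mem (cA a b (Itv.mk s01) (mem_set Aa) (mem_set Ab)).
- apply/mem_set; apply: cA => //; last by rewrite addrC subrK.
  by rewrite subr_ge0.
Qed.

Lemma convex_convex_hull (R : realType) (E : lmodType R) (A : set E) :
  convex_set (convex_hull A).
Proof.
apply/convex_setP => s t a b s0 t0 st ha hb C [cC AC].
by move/convex_setP: (cC); apply=> //; [apply: ha | apply: hb].
Qed.

Lemma exists_convex_weights (R : realFieldType) (l r x : R) : l <= x <= r ->
  exists s t : R, [/\ 0 <= s, 0 <= t, s + t = 1 & s * l + t * r = x].
Proof.
move=> /andP[lx xr]; have [l_r|lr] := eqVneq l r.
  by exists 1, 0; split; lra.
have d0 : 0 < r - l by rewrite subr_gt0 lt_neqAle lr (le_trans lx xr).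
exists ((r - x) / (r - l)), ((x - l) / (r - l)).
split; first by rewrite divr_ge0 ?subr_ge0 // ltW // -subr_gt0.
- by rewrite divr_ge0 ?subr_ge0 // ltW // -subr_gt0.
- by field; rewrite gt_eqF.
- by field; rewrite gt_eqF.
Qed.

Section Assortment.
Variables (R : realType) (n : nat) (u0 : R) (u : 'I_n -> R).
Hypotheses (hu0 : 0 < u0) (hu : forall k : 'I_n, 0 <= u k).

Local Notation yspace := (yspace R n).
Local Notation pspace := (pspace R n).
Implicit Types (q a b : yspace) (K : set yspace).

(** * Mass and cones *)

Definition mass q : R := u0 * q.1 + \sum_(k < n) u k * q.2 0 k.

Definition cone : set yspace :=
  [set q : yspace | 0 <= q.1 /\ forall k : 'I_n, 0 <= q.2 0 k <= q.1].

Definition conic K : Prop :=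
  forall (s t : R) a b, 0 <= s -> 0 <= t -> K a -> K b -> K (s *: a + t *: b).

Lemma mass_lin (s t : R) a b :
  mass (s *: a + t *: b) = s * mass a + t * mass b.
Proof.
rewrite /mass /= !mulrDr !mulr_sumr addrACA -big_split /=.
congr (_ + _); first by rewrite /GRing.scale /=; ring.
by apply: eq_bigr => k _; rewrite !mxE; ring.
Qed.

Lemma massB a b : mass (a - b) = mass a - mass b.
Proof.
by have := mass_lin 1 (-1) a b; rewrite scale1r scaleN1r mul1r mulN1r.
Qed.

Lemma mass0 : mass 0 = 0.
Proof. by have := massB 0 0; rewrite !subrr. Qed.

Lemma le_mass a b : a.1 <= b.1 -> (forall k, a.2 0 k <= b.2 0 k) ->
  mass a <= mass b.
Proof.
move=> h0 h; rewrite lerD ?ler_sum // => [|k _]; apply: ler_wpM2l => //.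
exact: ltW.
Qed.

Lemma mass_ge0 q : cone q -> 0 <= mass q.
Proof.
case=> q0 qk; rewrite -mass0; apply: le_mass => // k.
by rewrite mxE; case/andP: (qk k).
Qed.

Lemma cone_mass0 q : cone q -> mass q = 0 -> q = 0.
Proof.
case: q => y0 y [/= q0 qk] /eqP; rewrite paddr_eq0; first last.
- by apply: sumr_ge0 => k _; rewrite mulr_ge0 //; case/andP: (qk k).
- by rewrite mulr_ge0 // ltW.
case/andP=> /=; rewrite mulf_eq0 gt_eqF //= => /eqP y00 _.
rewrite /GRing.zero /= y00; congr pair; apply/rowP => k; rewrite mxE.
by have := qk k; rewrite y00 -eq_le => /eqP.
Qed.

Lemma conic_cone : conic cone.
Proof.
move=> s t a b s0 t0 [a0 ak] [b0 bk]; split=> [|k] /=.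
  by rewrite addr_ge0 ?mulr_ge0.
rewrite !mxE; have /andP[ak0 ak1] := ak k; have /andP[bk0 bk1] := bk k.
by rewrite addr_ge0 ?mulr_ge0 //= lerD ?ler_wpM2l.
Qed.

Lemma conicI K K' : conic K -> conic K' -> conic (K `&` K').
Proof.
move=> cK cK' s t a b s0 t0 [Ka K'a] [Kb K'b].
by split; [apply: cK | apply: cK'].
Qed.

Lemma conicZ K (s : R) a : conic K -> 0 <= s -> K a -> K (s *: a).
Proof.
by move=> cK s0 Ka; have := cK s 0 a a s0 (lexx 0) Ka Ka; rewrite scale0r addr0.
Qed.

(** * The hull of two slices *)

Definition two_slices K0 K1 : set pspace :=
  [set p : pspace | mass p.2 = 1 /\ (p.1 = 0 /\ K0 p.2 \/ p.1 = 1 /\ K1 p.2)].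

(** The component [a] plays the role of [x_j q], the product that the convex
    combinations of points with [x_j] binary linearize. *)
Definition split_set K0 K1 : set pspace :=
  [set p : pspace |
    mass p.2 = 1 /\ exists a, [/\ K1 a, K0 (p.2 - a) & mass a = p.1]].

Section TwoSlices.
Variables K0 K1 : set yspace.
Hypotheses (conic0 : conic K0) (conic1 : conic K1).
Hypotheses (apex0 : K0 0) (apex1 : K1 0).
Hypotheses (sub0 : K0 `<=` cone) (sub1 : K1 `<=` cone).

Lemma convex_split_set : convex_set (split_set K0 K1).
Proof.
apply/convex_setP => s t p p' s0 t0 st [mp [a [Ka Ka' ma]]].
move=> [mp' [b [Kb Kb' mb]]].
split; first by rewrite /= mass_lin mp mp' !mulr1.
exists (s *: a + t *: b); split; first exact: conic1.
- rewrite /= opprD addrACA -!scalerBr; exact: conic0.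
- by rewrite mass_lin ma mb.
Qed.

(** When both [a] and [p.2 - a] have positive mass, rescaling each of them to
    mass [1] exhibits [p] as a convex combination of points of the two slices.
    A component of mass [0] vanishes, because [u_0 > 0] forces its entry [y_0],
    which bounds the others, to be [0]; then [p] itself is in a slice. *)
Lemma convex_hull_two_slices :
  convex_hull (two_slices K0 K1) = split_set K0 K1.
Proof.
apply/seteqP; split.
  apply: smallest_sub; first exact: convex_split_set.
  move=> [x q] [/= mq [[-> Kq]|[-> Kq]]]; split=> //=.
  - by exists 0; rewrite subr0 mass0.
  - by exists q; rewrite subrr.
move=> [x q] [/= mq [a [Ka Kb ma]]].
have mb : mass (q - a) = 1 - x by rewrite massB mq ma.
have x0 : 0 <= x by rewrite -ma; exact/mass_ge0/sub1.
have x1 : 0 <= 1 - x by rewrite -mb; exact/mass_ge0/sub0.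
have [x_0|x_neq0] := eqVneq x 0.
  have a0 : a = 0 by apply: cone_mass0; [exact: sub1 | rewrite ma].
  apply: sub_gen_smallest; split=> //=; left; split=> //.
  by move: Kb; rewrite a0 subr0.
have [x_1|x_neq1] := eqVneq (1 - x) 0.
  have b0 : q - a = 0 by apply: cone_mass0; [exact: sub0 | rewrite mb].
  apply: sub_gen_smallest; split=> //=; right; split; first by lra.
  by move/eqP: b0; rewrite subr_eq0 => /eqP ->.
have -> : (x, q) = x *: (1, x^-1 *: a) + (1 - x) *: (0, (1 - x)^-1 *: (q - a))
    :> pspace.
  apply/pair_equal_spec; split.
    by rewrite /= scaler0 addr0; exact/esym/mulr1.
  by rewrite /= !scalerA !divff // !scale1r addrC subrK.
move/convex_setP: (@convex_convex_hull R pspace (two_slices K0 K1)).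
apply => //.
- by rewrite addrC subrK.
- apply: sub_gen_smallest; split=> /=.
    by have := mass_lin x^-1 0 a a; rewrite scale0r addr0 mul0r addr0 ma mulVf.
  by right; split=> //; apply: conicZ => //; rewrite invr_ge0.
- apply: sub_gen_smallest; split=> /=.
    have := mass_lin (1 - x)^-1 0 (q - a) (q - a).
    by rewrite scale0r addr0 mul0r addr0 mb mulVf.
  by left; split=> //; apply: conicZ => //; rewrite invr_ge0.
Qed.

(** The admissible first components of [q] form a convex set, so their masses
    fill an interval. *)
Lemma split_between (x : R) q a a' : mass q = 1 ->
  K1 a -> K0 (q - a) -> K1 a' -> K0 (q - a') -> mass a <= x <= mass a' ->
  split_set K0 K1 (x, q).
Proof.
move=> mq Ka Kb Ka' Kb' /exists_convex_weights[s [t [s0 t0 st sx]]].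
split=> //; exists (s *: a + t *: a'); split; first exact: conic1.
- rewrite /= -[q in X in K0 X]scale1r -st scalerDl opprD addrACA -!scalerBr.
  exact: conic0.
- by rewrite mass_lin.
Qed.

End TwoSlices.

(** * The largest admissible parts *)

Section Product.
Variable j : 'I_n.

Definition top_part q : yspace :=
  (q.2 0 j, \row_k Num.min (q.2 0 j) (q.2 0 k)).

Definition bottom_part q : yspace :=
  (q.1 - q.2 0 j,
   \row_k if k == j then 0 else Num.min (q.1 - q.2 0 j) (q.2 0 k)).

Definition top_cone : set yspace := cone `&` [set q : yspace | q.1 <= q.2 0 j].
Definition bottom_cone : set yspace := cone `&` [set q : yspace | q.2 0 j <= 0].

Lemma conic_top_cone : conic top_cone.
Proof.
apply: conicI; first exact: conic_cone.
by move=> s t a b s0 t0 /= ha hb; rewrite !mxE lerD // ler_wpM2l.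
Qed.

Lemma conic_bottom_cone : conic bottom_cone.
Proof.
apply: conicI; first exact: conic_cone.
move=> s t a b s0 t0 /= ha hb; rewrite !mxE.
by rewrite -[leRHS]addr0 lerD // mulr_ge0_le0.
Qed.

Lemma top_cone_top_part q : cone q -> top_cone (top_part q).
Proof.
move=> [q0 qk]; have /andP[qj0 qj1] := qk j.
split; last by rewrite /= mxE minxx.
split=> //= k; rewrite mxE le_min qj0 /= ge_min lexx andbT.
by case/andP: (qk k).
Qed.

(** Subtracting [top_part q] preserves [y_k <= y_0] because the slack
    [y_0 - y_k] only drops by [y_j - min y_j y_k = max 0 (y_j - y_k)], which is
    at most [y_0 - y_k] itself. *)
Lemma bottom_cone_sub_top_part q : cone q -> bottom_cone (q - top_part q).
Proof.
move=> [q0 qk]; have /andP[qj0 qj1] := qk j.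
split; last by rewrite /= !mxE minxx subrr.
split=> [|k] /=; first by rewrite subr_ge0.
rewrite !mxE; have /andP[qk0 qk1] := qk k.
by case: (leP (q.2 0 j) (q.2 0 k)) => ?; apply/andP; split; lra.
Qed.

Lemma bottom_cone_bottom_part q : cone q -> bottom_cone (bottom_part q).
Proof.
move=> [q0 qk]; have /andP[qj0 qj1] := qk j.
split; last by rewrite /= mxE eqxx.
split=> [|k] /=; first by rewrite subr_ge0.
rewrite mxE; have /andP[qk0 qk1] := qk k.
case: eqP => // _; first by rewrite lexx subr_ge0.
by case: (leP (q.1 - q.2 0 j) (q.2 0 k)) => ?; apply/andP; split; lra.
Qed.

(** For [k != j] the slack [y_0 - y_k] drops by [max 0 (y_0 - y_j - y_k)], which
    is at most [y_0 - y_k] because [0 <= y_j]; for [k = j] it drops to [0]. *)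
Lemma top_cone_sub_bottom_part q : cone q -> top_cone (q - bottom_part q).
Proof.
move=> [q0 qk]; have /andP[qj0 qj1] := qk j.
split; last by rewrite /= !mxE eqxx; lra.
split=> [|k] /=; first by lra.
rewrite !mxE; have /andP[qk0 qk1] := qk k.
case: eqP => [->|_]; first by apply/andP; split; lra.
by case: (leP (q.1 - q.2 0 j) (q.2 0 k)) => ?; apply/andP; split; lra.
Qed.

(** Every entry of [a] is at most [a_0 <= a_j <= y_j]. *)
Lemma mass_le_top_part q a : top_cone a -> cone (q - a) ->
  mass a <= mass (top_part q).
Proof.
move=> [[a0 ak] /= aj] [_ bk].
have le_aq k : a.2 0 k <= q.2 0 k.
  by have /andP[] := bk k; rewrite /= !mxE subr_ge0.
apply: le_mass => [|k] /=; first exact: le_trans (le_aq j).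
rewrite mxE le_min le_aq andbT.
by have /andP[_ /le_trans] := ak k; apply; apply: le_trans (le_aq j).
Qed.

(** Every entry of [b] is at most [b_0], and [b_0 <= y_0 - y_j] follows from
    [y_j - b_j <= y_0 - b_0] and [b_j <= 0]. *)
Lemma mass_le_bottom_part q b : bottom_cone b -> cone (q - b) ->
  mass b <= mass (bottom_part q).
Proof.
move=> [[b0 bk] /= bj] [_ ak].
have le_bq k : b.2 0 k <= q.2 0 k.
  by have /andP[] := ak k; rewrite /= !mxE subr_ge0.
have b0q : b.1 <= q.1 - q.2 0 j.
  by have /andP[] := ak j; rewrite /= !mxE; lra.
apply: le_mass => // k; rewrite mxE; case: eqP => [->//|_].
rewrite le_min le_bq andbT; have /andP[_ /le_trans] := bk k; exact.
Qed.

(** * The inequalities as choices in the minima *)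

Lemma cap_gt0 (S : {set 'I_n}) : 0 < u0 + \sum_(i in S) u i.
Proof. by apply: ltr_wpDr => //; apply: sumr_ge0. Qed.

Lemma under_ineqE (S : {set 'I_n}) (p : pspace) :
  under_ineq u0 u j S p <->
  p.1 <= mass (p.2.2 0 j,
               \row_k if k \in j |: S then p.2.2 0 j else p.2.2 0 k).
Proof.
case: p => x [y0 y]; rewrite /under_ineq /alpha /mass /=.
have D0 := cap_gt0 (j |: S); set D := u0 + _ in D0 *.
have -> : \sum_k u k * (\row_k if k \in j |: S then y 0 j else y 0 k) 0 k =
    (D - u0) * y 0 j + \sum_(k | k \notin j |: S) u k * y 0 k.
  rewrite (bigID (mem (j |: S))) /= /D [u0 + _]addrC addrK mulr_suml.
  by congr (_ + _); apply: eq_bigr => k; rewrite mxE;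
    [move=> -> | move/negbTE ->].
under eq_bigr do rewrite -mulrA mulrCA.
rewrite -mulr_sumr -mulrBr ler_pdivrMl // lerBlDr addrA -mulrDl.
by rewrite [u0 + _]addrC subrK.
Qed.

(** The normalization [mass = 1] trades the terms [u_t y_t] with [t] in [S] for
    those outside [S]; this makes Over_S the image of Under_S under the
    exchange of [x_j] with [1 - x_j] and of [y_j] with [y_0 - y_j], except that
    position [j] contributes nothing. *)
Lemma over_ineqE (S : {set 'I_n}) (p : pspace) : j \notin S -> mass p.2 = 1 ->
  over_ineq u0 u j S p <->
  1 - p.1 <= mass (p.2.1 - p.2.2 0 j,
    \row_k if k == j then 0
           else if k \in S then p.2.1 - p.2.2 0 j else p.2.2 0 k).
Proof.
case: p => x [y0 y] jS; rewrite /over_ineq /alpha /mass /=.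
have := cap_gt0 (j |: S); rewrite big_setU1 //=.
set U := \sum_(i in S) u i => D0.
have sum_split (F : 'I_n -> R) : \sum_k F k =
    F j + \sum_(k in S) F k + \sum_(k | k \notin j |: S) F k.
  by rewrite (bigID (mem (j |: S))) /= big_setU1.
rewrite sum_split; under [in X in _ <-> X]eq_bigr do rewrite mxE.
set A := \sum_(k in S) u k * y 0 k; set T := \sum_(k | _) u k * y 0 k => mq.
have -> : \sum_k u k * (if k == j then 0
      else if k \in S then y0 - y 0 j else y 0 k) = U * (y0 - y 0 j) + T.
  rewrite sum_split eqxx mulr0 add0r /U mulr_suml.
  congr (_ + _); apply: eq_bigr => k; first move=> kS.
    by rewrite kS ifN_eq //; apply: contraNneq jS => <-.
  by rewrite !inE negb_or => /andP[/negbTE -> /negbTE ->].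
have -> : \sum_(t in S) u t * (u0 + (u j + U))^-1 * y 0 t =
    (u0 + (u j + U))^-1 * A.
  by rewrite mulr_sumr; apply: eq_bigr => k _; rewrite -mulrA mulrCA.
set D := u0 + _ in D0 *.
have -> : D^-1 * x + (1 - (u0 + u j) / D) * y0 - D^-1 * A =
    D^-1 * (x + U * y0 - A) by rewrite /D; field; rewrite -/D gt_eqF.
rewrite ler_pdivlMl // /D; split=> ?; lra.
Qed.

(** The strongest inequality replaces every [y_k >= y_j] by [y_j]. *)
Lemma under_all_iff (p : pspace) :
  (forall S : {set 'I_n}, j \notin S -> under_ineq u0 u j S p) <->
  p.1 <= mass (top_part p.2).
Proof.
split=> [h|h S jS].
- pose S := [set k | k != j & p.2.2 0 j <= p.2.2 0 k].
  have jS : j \notin S by rewrite !inE eqxx.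
  move/under_ineqE: (h S jS) => /le_trans; apply; apply: le_mass => //= k.
  rewrite !mxE !inE; case: eqP => [->|_] /=; first by rewrite minxx.
  by case: (leP (p.2.2 0 j) (p.2.2 0 k)).
- apply/under_ineqE; apply: le_trans h _; apply: le_mass => //= k.
  by rewrite !mxE; case: ifP; rewrite ge_min lexx ?orbT.
Qed.

(** The strongest inequality replaces every [y_k >= y_0 - y_j] by
    [y_0 - y_j]. *)
Lemma over_all_iff (p : pspace) : mass p.2 = 1 ->
  (forall S : {set 'I_n}, j \notin S -> over_ineq u0 u j S p) <->
  1 - p.1 <= mass (bottom_part p.2).
Proof.
move=> mp; split=> [h|h S jS].
- pose S := [set k | k != j & p.2.1 - p.2.2 0 j <= p.2.2 0 k].
  have jS : j \notin S by rewrite !inE eqxx.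
  move/(over_ineqE jS mp): (h S jS) => /le_trans; apply.
  apply: le_mass => //= k.
  rewrite !mxE !inE; case: eqP => //= _.
  by case: (leP (p.2.1 - p.2.2 0 j) (p.2.2 0 k)).
- apply/over_ineqE => //; apply: le_trans h _; apply: le_mass => //= k.
  rewrite !mxE; case: eqP => // _.
  by case: ifP; rewrite ge_min lexx ?orbT.
Qed.

(** * The three hulls *)

Lemma YE q : Y u0 u q <-> mass q = 1 /\ cone q.
Proof.
split=> [[mq qk]|[mq [_ qk]]]; split=> //; split=> //.
by have /andP[] := qk j; apply: le_trans.
Qed.

Lemma two_slicesP K0 K1 (p : pspace) : K0 `<=` cone -> K1 `<=` cone ->
  two_slices K0 K1 p <->
  ([set 0; 1] `*` Y u0 u) p /\ (p.1 = 0 -> K0 p.2) /\ (p.1 = 1 -> K1 p.2).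
Proof.
move=> sub0 sub1; split=> [[mp [[p1 Kp]|[p1 Kp]]]|].
- split; first by split; [left | apply/YE; split=> //; exact: sub0].
  by split=> //; rewrite p1 => /esym/eqP; rewrite oner_eq0.
- split; first by split; [right | apply/YE; split=> //; exact: sub1].
  by split=> //; rewrite p1 => /eqP; rewrite oner_eq0.
- move=> [[p01 /YE[mp _]] [h0 h1]]; split=> //.
  by case: p01 => p1; [left | right]; split=> //; auto.
Qed.

Lemma B_geE : B_ge u0 u j = two_slices cone top_cone.
Proof.
apply/seteqP; split=> [p|p /two_slicesP].
- move=> [pY pj]; apply/two_slicesP => //; first by move=> ? [].
  split=> //; case: pY => _ /YE[_ cp]; split=> // p1; split=> //=.
  by move: pj; rewrite p1 mulr1.
- case=> //; first by move=> ? [].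
  move=> [p01 pY] [_ h1]; split=> //; case: p01 => p1.
    by rewrite p1 mulr0; case: pY => _ /(_ j)/andP[].
  by rewrite p1 mulr1; case: (h1 p1).
Qed.

Lemma B_leE : B_le u0 u j = two_slices bottom_cone cone.
Proof.
apply/seteqP; split=> [p|p /two_slicesP].
- move=> [pY pj]; apply/two_slicesP => //; first by move=> ? [].
  split=> //; case: pY => _ /YE[_ cp]; split=> // p1; split=> //=.
  by move: pj; rewrite p1 mulr0.
- case=> //; first by move=> ? [].
  move=> [p01 pY] [h0 _]; split=> //; case: p01 => p1.
    by rewrite p1 mulr0; case: (h0 p1).
  by rewrite p1 mulr1; case: pY => _ /(_ j)/andP[].
Qed.

Lemma B_eqE : B_eq u0 u j = two_slices bottom_cone top_cone.
Proof.
apply/seteqP; split=> [p [pY pj]|p].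
- apply/two_slicesP; [by move=> ? [] | by move=> ? [] | split=> //].
  by case: pY => _ /YE[_ cp]; split=> p1; split=> //=;
    rewrite pj p1 ?mulr0 ?mulr1.
- move=> /two_slicesP; case; [by move=> ? [] | by move=> ? [] |].
  move=> [p01 pY] [h0 h1]; split=> //.
  apply/eqP; case: p01 => p1; rewrite p1 ?mulr0 ?mulr1 eq_le.
    by have [[_ /(_ j)/andP[-> _]] ->] := h0 p1.
  by have [[_ /(_ j)/andP[_ ->]] ->] := h1 p1.
Qed.

Lemma cone0 : cone 0.
Proof. by split=> // k; rewrite mxE lexx. Qed.

Lemma top_cone0 : top_cone 0.
Proof. by split; [exact: cone0 | rewrite /= mxE]. Qed.

Lemma bottom_cone0 : bottom_cone 0.
Proof. by split; [exact: cone0 | rewrite /= mxE]. Qed.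

Lemma split_set_bounds K0 K1 (p : pspace) : K0 `<=` cone -> K1 `<=` cone ->
  split_set K0 K1 p -> (`[0, 1] `*` Y u0 u) p.
Proof.
case: p => x q sub0 sub1 [/= mq [a [/sub1 Ka /sub0 Kb ma]]]; split=> /=.
  have := mass_ge0 Ka; have := mass_ge0 Kb; rewrite massB mq ma subr_ge0.
  by rewrite in_itv /= => -> ->.
apply/YE; split=> //; rewrite -[q]scale1r -[q in 1 *: q](subrK a).
by rewrite scalerDr; apply: conic_cone.
Qed.

Lemma split_set_geP (p : pspace) : split_set cone top_cone p <->
  (`[0, 1] `*` Y u0 u) p /\ p.1 <= mass (top_part p.2).
Proof.
split=> [pE|].
  split; first by apply: split_set_bounds pE => // ? [].
  by case: pE => _ [a [Ka Kb <-]]; apply: mass_le_top_part.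
case: p => x q [[/= x01 /YE[mq cq]] xq].
apply: (split_between conic_cone conic_top_cone mq top_cone0 _
  (top_cone_top_part cq)).
- by rewrite subr0.
- by case: (bottom_cone_sub_top_part cq).
- by rewrite mass0 xq andbT; move: x01; rewrite in_itv => /andP[].
Qed.

Lemma split_set_leP (p : pspace) : split_set bottom_cone cone p <->
  (`[0, 1] `*` Y u0 u) p /\ 1 - p.1 <= mass (bottom_part p.2).
Proof.
split=> [pE|].
  split; first by apply: split_set_bounds pE => // ? [].
  case: pE => mq [a [Ka Kb <-]]; rewrite -mq -massB.
  by apply: mass_le_bottom_part => //; rewrite opprB addrC subrK.
case: p => x q [[/= x01 /YE[mq cq]] xq].
have [ca _] := top_cone_sub_bottom_part cq.
apply: (split_between conic_bottom_cone conic_cone mq ca _ cq).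
- by rewrite opprB addrC subrK; apply: bottom_cone_bottom_part.
- by rewrite subrr; apply: bottom_cone0.
- by rewrite massB mq lerBlDr -lerBlDl xq; move: x01; rewrite in_itv => /andP[].
Qed.

Lemma split_set_eqP (p : pspace) : split_set bottom_cone top_cone p <->
  (`[0, 1] `*` Y u0 u) p /\
  (p.1 <= mass (top_part p.2) /\ 1 - p.1 <= mass (bottom_part p.2)).
Proof.
split=> [pE|].
  split; first by apply: split_set_bounds pE => ? [].
  case: pE => mq [a [Ka Kb <-]]; split.
    by apply: mass_le_top_part => //; case: Kb.
  rewrite -mq -massB; apply: mass_le_bottom_part => //.
  by rewrite opprB addrC subrK; case: Ka.
case: p => x q [[/= x01 /YE[mq cq]] [xq1 xq0]].
apply: (split_between conic_bottom_cone conic_top_cone mq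
  (top_cone_sub_bottom_part cq) _ (top_cone_top_part cq)).
- by rewrite opprB addrC subrK; apply: bottom_cone_bottom_part.
- exact: bottom_cone_sub_top_part.
- by rewrite massB mq lerBlDr -lerBlDl xq0.
Qed.

End Product.
End Assortment.

Theorem theorem5 (R : realType) (n : nat) (u0 : R) (u : 'I_n -> R)
    (hu0 : 0 < u0) (hu : forall k : 'I_n, 0 <= u k) (j : 'I_n) :
  [/\ convex_hull (B_ge u0 u j) =
        [set p : pspace R n | (`[0, 1] `*` Y u0 u) p /\
                 forall S : {set 'I_n}, j \notin S -> under_ineq u0 u j S p],
      convex_hull (B_le u0 u j) =
        [set p : pspace R n | (`[0, 1] `*` Y u0 u) p /\
                 forall S : {set 'I_n}, j \notin S -> over_ineq u0 u j S p]
    & convex_hull (B_eq u0 u j) =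
        [set p : pspace R n | (`[0, 1] `*` Y u0 u) p /\
                 forall S : {set 'I_n}, j \notin S ->
                   under_ineq u0 u j S p /\ over_ineq u0 u j S p]].
Proof.
have cone_top : top_cone j `<=` @cone R n by move=> ? [].
have cone_bottom : bottom_cone j `<=` @cone R n by move=> ? [].
have cC := @conic_cone R n.
have cT := @conic_top_cone R n j.
have cB := @conic_bottom_cone R n j.
have zC := @cone0 R n.
have zT := @top_cone0 R n j.
have zB := @bottom_cone0 R n j.
have YE1 p : Y u0 u p -> mass u0 u p = 1 by case.
split; apply/predeqP => p.
- rewrite B_geE // convex_hull_two_slices //=.
  by rewrite (propext (under_all_iff hu0 hu j p)); exact: split_set_geP.
- rewrite B_leE // convex_hull_two_slices //=.
  rewrite (propext (split_set_leP hu0 hu j p)).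
  by split=> -[pY h]; split=> //;
    apply/(over_all_iff hu0 hu) => //; exact/YE1/pY.2.
- rewrite B_eqE // convex_hull_two_slices //=.
  rewrite (propext (split_set_eqP hu0 hu j p)).
  split=> [[pY [ht hb]]|[pY h]]; split=> //.
    have mp := YE1 _ pY.2.
    by move=> S jS; split; move: S jS;
      [exact/under_all_iff | exact/over_all_iff].
  split; first by apply/(under_all_iff hu0 hu) => S /h[].
  by apply/(over_all_iff hu0 hu) => [|S /h[]//]; exact/YE1/pY.2.
Qed.
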